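(* Let $n,m\in \mathbb{Z}^+$ with $n,m\geq 2$, and let $P_m$ be the path on $m$ vertices. Then \[ \chi_n(P_m)= \begin{cases} 2, & \text{if } n\geq 3 \text{ or } (n = 2 \text{ and } m\leq 3), \\ 3, & \text{if } n = 2 \text{ and } m \geq 4. \end{cases}\]
   Context: For a graph $G=(V,E)$, a $\mathbb{Z}$-labeling is a map $\ell:V\to\mathbb{Z}$; its order is the size of its range; it is proper if adjacent vertices get different labels. $N[v]$ is the closed neighborhood of $v$. A closed coloring with nonzero remainders mod $n$ is a labeling with $\sum_{w\in N[v]}\ell(w)\not\equiv 0 \pmod n$ for all $v\in V$. $\chi_n(G)$ denotes the minimum order of a proper closed coloring with nonzero remainders mod $n$ of $G$. *)

(* Defs.v *)
From HB Require Import structures.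
From mathcomp Require Import all_boot all_order all_algebra.

Set Implicit Arguments.
Unset Strict Implicit.
Unset Printing Implicit Defensive.

Import GRing.Theory.
Local Open Scope ring_scope.

(* Finite simple graphs. *)
Record sgraph := SGraph {
  vertex :> finType;
  adj : rel vertex;
  adj_sym : symmetric adj;
  adj_irrefl : irreflexive adj
}.

Definition closed_nbhd (G : sgraph) (v : G) : {set G} :=
  [set w | (w == v) || adj v w].

Definition label_order (G : sgraph) (l : G -> int) : nat :=
  size (undup (codom l)).

Definition proper_labeling (G : sgraph) (l : G -> int) : Prop :=
  forall u v : G, adj u v -> l u != l v.

Definition closed_nonzero_coloring (n : nat) (G : sgraph) (l : G -> int) : Prop :=
  forall v : G, (\sum_(w in closed_nbhd v) l w != 0 %[mod n])%Z.

(* [is_chi n G k] means chi_n(G) = k. The minimum is stated as a relation, so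
   that no default value is needed for graphs without any such labeling; at
   most one k can satisfy it. *)
Definition is_chi (n : nat) (G : sgraph) (k : nat) : Prop :=
  (exists l : G -> int,
     [/\ proper_labeling l, closed_nonzero_coloring n l & label_order l = k])
  /\ (forall l : G -> int,
        proper_labeling l -> closed_nonzero_coloring n l ->
        (k <= label_order l)%N).

Definition path_adj (m : nat) : rel 'I_m :=
  fun i j => (i.+1 == j :> nat) || (j.+1 == i :> nat).

Lemma path_adj_sym (m : nat) : symmetric (@path_adj m).
Proof. by move=> i j; rewrite /path_adj orbC. Qed.

Lemma path_adj_irrefl (m : nat) : irreflexive (@path_adj m).
Proof. by move=> i; rewrite /path_adj orbb; apply: gtn_eqF. Qed.

Definition path_graph (m : nat) : sgraph :=
  SGraph (@path_adj_sym m) (@path_adj_irrefl m).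

(* Main.v *)
Require Import Defs.
From mathcomp Require Import all_boot all_order all_algebra.
From mathcomp Require Import zify.

(** With two labels a proper labeling of a path alternates.  The labels
    0, 1, 0, 1, ... have closed neighborhood sums 1 and 2, the sum 2 occurring
    only at interior vertices of even index; this settles all cases but n = 2,
    m >= 4.  In that case, an alternating labeling a, b, a, b, ... would need
    a + b, 2a + b and a + 2b all odd, which is impossible, whereas the labels
    0, 1, 2 repeated cyclically have interior sums 3; the starting point of the
    cycle is chosen so that the sums at both ends are also odd. *)

Import GRing.Theory.
Local Open Scope ring_scope.

(** Each of the three terms is a sum over ['I_m] restricted to one index, so a comparison vertex by
    vertex suffices. Taking [f] on [nat] spares bound proofs for [v.-1] and [v.+1]. *)
Lemma path_nbhd_sum (m : nat) (f : nat -> int) (v : 'I_m) :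
  \sum_(w in closed_nbhd (v : path_graph m)) f (w : 'I_m) =
  (if (0 < v)%N then f v.-1 else 0) + f v + (if (v.+1 < m)%N then f v.+1 else 0).
Proof.
have -> : (if (0 < v)%N then f v.-1 else 0) =
          \sum_(w < m) (if w.+1 == v :> nat then f w else 0).
  rewrite -big_mkcond /=; case: v => -[|k] km /=; first by rewrite big_pred0.
  rewrite (eq_bigl (fun w : 'I_m => w == k :> nat)) //.
  by rewrite (@big_ord1_eq _ 0 +%R f) (ltnW km).
have -> : f v = \sum_(w < m) (if w == v :> nat then f w else 0).
  by rewrite -big_mkcond (@big_ord1_eq _ 0 +%R f) ltn_ord.
rewrite -(@big_ord1_eq _ 0 +%R f) (big_mkcond (fun w : 'I_m => _ == _)).
rewrite [LHS]big_mkcond -!big_split /=.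
apply: eq_bigr => w _; rewrite inE /= /path_adj -val_eqE /=.
by do !case: eqP => /=; move=> *; rewrite ?addr0 ?add0r //; exfalso; lia.
Qed.

Lemma label_order_ge (G : sgraph) (l : G -> int) (s : seq int) :
  uniq s -> {subset s <= codom l} -> (size s <= label_order l)%N.
Proof. by move=> us sl; apply: uniq_leq_size => // x /sl; rewrite mem_undup. Qed.

Lemma label_order_le (G : sgraph) (l : G -> int) (s : seq int) :
  (forall v, l v \in s) -> (label_order l <= size s)%N.
Proof.
move=> ls; apply: uniq_leq_size; first exact: undup_uniq.
by move=> x; rewrite mem_undup => /codomP[v ->].
Qed.

Lemma proper_order_ge2 (G : sgraph) (l : G -> int) (u v : G) :
  adj u v -> proper_labeling l -> (2 <= label_order l)%N.
Proof.
move=> uv pl; apply: (@label_order_ge _ _ [:: l u; l v]).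
  by rewrite /= inE pl.
by move=> x; rewrite !inE => /orP[] /eqP->; exact: codom_f.
Qed.

Lemma proper_order_ge3 (G : sgraph) (l : G -> int) (u v w : G) :
  adj u v -> adj v w -> l u != l w -> proper_labeling l ->
  (3 <= label_order l)%N.
Proof.
move=> uv vw luw pl; apply: (@label_order_ge _ _ [:: l u; l v; l w]).
  by rewrite /= !inE negb_or luw !pl.
by move=> x; rewrite !inE => /or3P[] /eqP->; exact: codom_f.
Qed.

Lemma path_order_ge2 (m : nat) (l : path_graph m -> int) :
  (2 <= m)%N -> proper_labeling l -> (2 <= label_order l)%N.
Proof.
move=> hm; have m0 : (0 < m)%N by exact: ltnW.
exact: (@proper_order_ge2 _ _ (Ordinal m0 : path_graph m) (Ordinal hm)).
Qed.

Lemma path_order_ge3 (m : nat) (l : path_graph m -> int) :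
  (4 <= m)%N -> proper_labeling l -> closed_nonzero_coloring 2 l ->
  (3 <= label_order l)%N.
Proof.
(* [f] extends [l] to [nat] so that [path_nbhd_sum] applies; the values at 0 to 3 are genuine
   labels, as the path has at least four vertices. *)
case: m l => // m l hm pl cl; pose f k := l (inord k : 'I_m.+1).
have sum_f (v : path_graph m.+1) :
    \sum_(w in closed_nbhd v) l w = \sum_(w in closed_nbhd v) f (w : 'I_m.+1).
  by apply: eq_bigr => w _; rewrite /f inord_val.
have step k : (k < m)%N ->
    @adj (path_graph m.+1) (inord k) (inord k.+1).
  by move=> km; rewrite /= /path_adj !inordK ?eqxx // ltnS ltnW.
have [f02|] := eqVneq (f 0%N) (f 2); last first.
  by move=> f02; apply: (proper_order_ge3 _ _ _ _ _ (step 0%N _) (step 1%N _)) => //; lia.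
have [f13|] := eqVneq (f 1%N) (f 3); last first.
  by move=> f13; apply: (proper_order_ge3 _ _ _ _ _ (step 1%N _) (step 2%N _)) => //; lia.
(* With a = [f 0] = [f 2] and b = [f 1] = [f 3], the sums at 1 and 2 make b and a odd, so the sum a
   + b at the end 0 is even. *)
have := cl (inord 0 : 'I_m.+1); have := cl (inord 1 : 'I_m.+1).
have := cl (inord 2 : 'I_m.+1).
rewrite !sum_f !path_nbhd_sum !inordK /= ?(hm, ltnW hm, ltnW (ltnW hm)) //; try lia.
by rewrite -f13 -f02; lia.
Qed.

Lemma chi_path_2 (n m : nat) : (2 <= n)%N -> (2 <= m)%N ->
  (3 <= n)%N \/ (n = 2%N /\ (m <= 3)%N) -> is_chi n (path_graph m) 2.
Proof.
move=> hn hm hnm; split; last by move=> l pl _; exact: path_order_ge2.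
pose f (k : nat) : int := (odd k)%:Z; exists (fun v : 'I_m => f v).
have pl : proper_labeling (fun v : path_graph m => f (v : 'I_m)).
  by move=> u v /orP[]/eqP<-; rewrite /f /=; case: odd.
split => //.
- move=> v; rewrite path_nbhd_sum /f; case: v => v vm /=.
  (* A sum 2 needs an even interior index, hence at least 2, so it forces [m] >= 4 and thus [n] >=
     3. *)
  set s := (X in (X %% _)%Z); have s_bounds : 0 < s < n%:Z.
    by rewrite {}/s; case: v vm => [|v] vm /=; do !case: ifP => ?; lia.
  by rewrite !modz_small; lia.
- apply/eqP; rewrite eqn_leq path_order_ge2 // andbT.
  by apply: (@label_order_le _ _ [:: 0; 1]) => v; rewrite /f; case: odd.
Qed.

Lemma chi_path_3 (m : nat) : (4 <= m)%N -> is_chi 2 (path_graph m) 3.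
Proof.
move=> hm; split; last by move=> l; exact: path_order_ge3.
(* An end sum is even only for the labels 2, 0. The path starts with 0, 1 and ends with 1, 2 if 3
   divides [m]; otherwise it starts with 1, 2 and ends with 0, 1 or 1, 2. *)
pose f (k : nat) : int := ((k + (m %% 3 != 0)%N) %% 3)%N.
have pl : proper_labeling (fun v : path_graph m => f (v : 'I_m)).
  by move=> u v /orP[]/eqP<-; rewrite /f /=; lia.
have cl : closed_nonzero_coloring 2 (fun v : path_graph m => f (v : 'I_m)).
  move=> v; rewrite path_nbhd_sum /f; case: v => v vm /=.
  by case: ifP => ?; case: ifP => ?; case: eqP => ? /=; lia.
exists (fun v : 'I_m => f v); split => //.
apply/eqP; rewrite eqn_leq path_order_ge3 // andbT.
apply: (@label_order_le _ _ [:: 0; 1; 2]) => v.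
by rewrite /f !inE; lia.
Qed.

Local Close Scope ring_scope.

Theorem theorem4p1 (n m : nat) (hn : 2 <= n) (hm : 2 <= m) :
  (3 <= n \/ (n = 2 /\ m <= 3) -> is_chi n (path_graph m) 2) /\
  (n = 2 /\ 4 <= m -> is_chi n (path_graph m) 3).
Proof.
split; first exact: chi_path_2.
by case=> ->; exact: chi_path_3.
Qed.
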